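(* Let $T = T_{\lambda,\pi}$ be an interval exchange transformation (with $m > 1$ an integer, $\lambda \in \Lambda_m$, $\pi \in \mathcal{S}_m$) that satisfies property V. Then the coding $s$ of the $T$-orbit of Lebesgue almost every $x \in I^\lambda$ with respect to any finite partition of $I^\lambda$ obeys $R(s) = T(s) = \infty$.
   Context: Let $\Lambda_m = \{ \lambda \in \mathbb{R}^m : \lambda_j > 0, \ 1 \le j \le m\}$. For $\lambda \in \Lambda_m$ let $\beta_0(\lambda) = 0$, $\beta_j(\lambda) = \sum_{i=1}^j \lambda_i$ for $1 \le j \le m$, $I_j^\lambda = [\beta_{j-1}(\lambda), \beta_j(\lambda))$, $|\lambda| = \sum_{i=1}^m \lambda_i$, and $I^\lambda = [0,|\lambda|)$. Let $\mathcal{S}_m$ be the group of permutations of $\{1,\ldots,m\}$, and for $\pi \in \mathcal{S}_m$ set $\lambda^\pi_j = \lambda_{\pi^{-1}(j)}$. The $(\lambda,\pi)$-interval exchange transformation $T_{\lambda,\pi} : I^\lambda \to I^\lambda$ is given by $x \mapsto x - \beta_{j-1}(\lambda) + \beta_{\pi(j)-1}(\lambda^\pi)$ for $x \in I_j^\lambda$, $1 \le j \le m$; it is a bijection. Write $|\cdot|$ for Lebesgue measure of sets. $T = T_{\lambda,\pi}$ satisfies property V if for every $\varepsilon > 0$ there are $N \ge 1$ and an interval $J \subseteq I^\lambda$ such that: (i) $J \cap T^l J = \emptyset$ for $1 \le l < N$; (ii) $T$ is linear on $T^l J$ for $0 \le l < N$; (iii) $|\bigcup_{l=0}^{N-1}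 T^l J| > (1-\varepsilon)|\lambda|$; (iv) $|J \cap T^N J| > (1-\varepsilon)|J|$. Coding: given a finite partition $I^\lambda = J_1 \sqcup \cdots \sqcup J_M$ and $x \in I^\lambda$, the coding of the $T$-orbit of $x$ is the two-sided sequence $s = (s_n)_{n \in \mathbb{Z}}$ with $s_n = l$ if and only if $T^n x \in J_l$. For a two-sided sequence $\omega = (\omega_k)_{k\in\mathbb{Z}}$ over a finite alphabet and $n \ge 1$, let $R_n(\omega) = 1 + \frac{1}{n} \sup \{ m : \omega_k = \omega_{k+n} \text{ for } 1 \le k \le m \}$ and $T_n(\omega) = 1 + \frac{1}{n} \sup \{ m : \omega_k = \omega_{k+n} \text{ and } \omega_{n+1-k} = \omega_{1-k} \text{ for } 1 \le k \le m \}$, where $m$ ranges over positive integers and $\sup\emptyset = 0$; set $R(\omega) = \limsup_{n\to\infty} R_n(\omega)$ and $T(\omega) = \limsup_{n\to\infty} T_n(\omega)$, elements of $[1,\infty]$. (The symbol $T(s)$ for a sequence $s$ is not to be confused with the map $T$.)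
   Formalization: The cells of the finite partition are required to be finite unions of intervals; for arbitrary cells the claim fails (code each orbit of an irrational rotation with property V by the Fibonacci word, so that R(s) < 4). *)

(* Defs.v *)
From mathcomp Require Import all_boot all_order all_fingroup all_algebra.
From mathcomp Require Import all_classical all_reals all_analysis.
Set Implicit Arguments.
Unset Strict Implicit.
Unset Printing Implicit Defensive.
Import Order.TTheory GRing.Theory Num.Theory.
Import numFieldNormedType.Exports.
Local Open Scope classical_set_scope.
Local Open Scope ring_scope.

(* Indices are 0-based: the mathematical index j in {1, ..., m} is the element
   of 'I_m of value j - 1. *)

Definition Lambda {R : realType} (m : nat) : set 'rV[R]_m :=
  [set lam | forall j, 0 < lam 0 j].

Definition beta {R : realType} {m : nat} (lam : 'rV[R]_m) (j : nat) : R :=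
  \sum_(i < m | (i < j)%N) lam 0 i.

Definition lam_total {R : realType} {m : nat} (lam : 'rV[R]_m) : R :=
  \sum_(i < m) lam 0 i.

Definition Ilam {R : realType} {m : nat} (lam : 'rV[R]_m) : set R :=
  `[0, lam_total lam[%classic.

Definition lam_perm {R : realType} {m : nat} (lam : 'rV[R]_m) (p : 'S_m) :
  'rV[R]_m := \row_j lam 0 (p^-1%g j).

(* Extended by the identity outside [Ilam lam]. If [Lambda lam], the
   index j below is unique. *)
Definition iet {R : realType} {m : nat} (lam : 'rV[R]_m) (p : 'S_m) (x : R) : R :=
  if [pick j : 'I_m | beta lam j <= x < beta lam j.+1] is Some j
  then x - beta lam j + beta (lam_perm lam p) (p j)
  else x.

Definition linear_on {R : realType} (f : R -> R) (A : set R) : Prop :=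
  exists a b : R, forall x, A x -> f x = a * x + b.

Definition propertyV {R : realType} {m : nat} (lam : 'rV[R]_m) (p : 'S_m) : Prop :=
  let T := iet lam p in
  let mu := @lebesgue_measure R in
  forall e : R, 0 < e ->
  exists (N : nat) (J : set R),
    [/\ (1 <= N)%N, is_interval J & J `<=` Ilam lam] /\
    [/\ forall l, (1 <= l < N)%N -> J `&` iter l T @` J = set0,
        forall l, (l < N)%N -> linear_on T (iter l T @` J),
        (((1 - e) * lam_total lam)%:E < mu (\bigcup_(l < N) iter l T @` J))%E &
        ((1 - e)%:E * mu J < mu (J `&` iter N T @` J))%E].

(* T^n for n in Z; negative powers iterate the inverse of T on [Ilam lam]. *)
Definition iet_pow {R : realType} {m : nat} (lam : 'rV[R]_m) (p : 'S_m)
    (n : int) (x : R) : R :=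
  match n with
  | Posz k => iter k (iet lam p) x
  | Negz k => iter k.+1 ('pinv_(fun=> 0) (Ilam lam) (iet lam p)) x
  end.

(* The cells of a finite partition are finite unions of intervals (of any
   kind); partitions into intervals are the special case of one interval per
   cell. For arbitrary measurable cells repetitions can be destroyed. *)
Definition finite_union_of_intervals {R : realType} (A : set R) : Prop :=
  exists (n : nat) (K : 'I_n -> set R),
    (forall i, is_interval (K i)) /\ A = \bigcup_i K i.

Definition interval_partition {R : realType} {m : nat} (lam : 'rV[R]_m)
    (M : nat) (J : 'I_M -> set R) : Prop :=
  classical_sets.partition [set: 'I_M] J (Ilam lam) /\
  forall l, finite_union_of_intervals (J l).

Definition is_coding {R : realType} {m : nat} (lam : 'rV[R]_m) (p : 'S_m)
    (M : nat) (J : 'I_M -> set R) (x : R) (s : int -> 'I_M) : Prop :=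
  forall (n : int) (l : 'I_M), s n = l <-> J l (iet_pow lam p n x).

(* Supremum of a set of natural numbers in the extended reals, with
   sup set0 = 0 ([ereal_sup set0] is -oo). *)
Definition nat_sup (R : realType) (P : set nat) : \bar R :=
  maxe 0%E (ereal_sup [set (m%:R)%:E | m in P]).

Definition rep_n (R : realType) {A : Type} (w : int -> A) (n : nat) : \bar R :=
  (1 + (n%:R^-1)%:E * nat_sup R [set m : nat | (0 < m)%N /\
     forall k : nat, (1 <= k <= m)%N -> w k%:Z = w (k%:Z + n%:Z)%R])%E.

Definition pinned_rep_n (R : realType) {A : Type} (w : int -> A) (n : nat) :
    \bar R :=
  (1 + (n%:R^-1)%:E * nat_sup R [set m : nat | (0 < m)%N /\
     forall k : nat, (1 <= k <= m)%N ->
       w k%:Z = w (k%:Z + n%:Z)%R /\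
       w (n%:Z + 1 - k%:Z)%R = w (1 - k%:Z)%R])%E.

(* The value at n = 0 is irrelevant to the limits superior. *)
Definition rep (R : realType) {A : Type} (w : int -> A) : \bar R :=
  limn_esup (rep_n R w).

Definition pinned_rep (R : realType) {A : Type} (w : int -> A) : \bar R :=
  limn_esup (pinned_rep_n R w).

(* Main.v *)
Require Import Defs.
From mathcomp Require Import all_boot all_order all_fingroup all_algebra.
From mathcomp Require Import all_classical all_reals all_analysis.
From mathcomp Require Import ring lra zify.
Import Order.TTheory GRing.Theory Num.Theory.
Import numFieldNormedType.Exports.
Local Open Scope classical_set_scope.
Local Open Scope ring_scope.
Set Implicit Arguments.
Unset Strict Implicit.
Unset Printing Implicit Defensive.

(** Property V provides, for every small [e], a tower of intervals
    [B, T B, ..., T^(N-1) B] that fills [Ilam] up to a proportion [e], on each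
    of which [T] is a translation. Hence [T^N] restricted to [B] is a
    translation by some [t], and the overlap of [B] with [T^N B] forces [|t|] to
    be less than [e] times the length of [B] ([return_drift]). Fix a number [L]
    of periods. If [x] in [B] is at distance more than [r = (L + 1) |t|] from
    the ends of [B], the orbit of [x] passes through the whole tower [L + 1]
    times in the past and [L + 1] times in the future, and on each level it
    stays within [r] of a fixed point. If moreover no end point of a cell lies
    within [r] of that point, on any level, then two visits of the orbit to the
    same level have the same code: the coding has period [N] on the window of
    [L] periods around time 0 ([tower_recurrent]).

    The starting points to be discarded are few. The levels are disjoint, so an
    end point of a cell lies in at most one of them and spoils a single interval
    of length [2 r] of the base, whatever the height of the tower
    ([tower_bad_centers]). With [d] end points, the discarded part of the tower
    has measure at most [N (d + 2) 2 r], which is less than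
    [2 (d + 2) (L + 1) e N |B|], and [N |B|] is at most the total length
    ([tower_height]). For fixed [L] this tends to 0 with [e]. So the points
    whose coding has, for some [N], period [N] on a window of [L] periods have
    full measure ([recurrent_orbit_ae]).

    For almost every [x] this happens for all [L] at once. The heights [N] need
    not tend to infinity with [L], for instance when [T] is periodic; but a
    window of [L] periods [N] is also a window of about [L / n] periods [n N],
    so both limits superior are infinite ([pinned_window]). *)

(** * Interval exchanges *)

Section Pieces.
Variables (R : realType) (m : nat).
Implicit Types (lam : 'rV[R]_m) (p : 'S_m) (x : R).

Lemma beta0 lam : beta lam 0 = 0.
Proof. by rewrite /beta big_pred0. Qed.

Lemma betaS lam (j : 'I_m) : beta lam j.+1 = beta lam j + lam 0 j.
Proof.
rewrite /beta (bigD1 j) ?ltnSn//= addrC; congr (_ + _).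
by apply: eq_bigl => i; rewrite ltnS ltn_neqAle andbC.
Qed.

Lemma beta_total lam : beta lam m = lam_total lam.
Proof. by apply: eq_bigl => i; rewrite ltn_ord. Qed.

Lemma beta_le lam (i j : nat) : Lambda lam -> (i <= j)%N ->
  beta lam i <= beta lam j.
Proof.
move=> lam_gt0 ij; rewrite /beta [leRHS](bigID (fun k : 'I_m => (k < i)%N))/=.
rewrite (eq_bigl (fun k : 'I_m => (k < j)%N && (k < i)%N)); last first.
  by move=> k; apply/idP/andP => [ki|[]//]; rewrite (leq_trans ki).
by rewrite lerDl sumr_ge0// => k _; apply/ltW/lam_gt0.
Qed.

Lemma beta_ge0 lam i : Lambda lam -> 0 <= beta lam i.
Proof. by move=> h; rewrite -(beta0 lam) beta_le. Qed.

Lemma beta_le_total lam (j : 'I_m) : Lambda lam ->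
  beta lam j.+1 <= lam_total lam.
Proof. by move=> h; rewrite -beta_total; apply: beta_le. Qed.

Lemma lam_total_ge0 lam : Lambda lam -> 0 <= lam_total lam.
Proof. by rewrite -beta_total; exact: beta_ge0. Qed.

Lemma piece_exists lam x : Ilam lam x ->
  exists j : 'I_m, beta lam j <= x < beta lam j.+1.
Proof.
rewrite /Ilam/= in_itv/= => /andP[x0 xW].
have : exists k, x < beta lam k by exists m; rewrite beta_total.
move=> /ex_minnP[[|k] xk kmin]; first by move: xk; rewrite beta0 ltNge x0.
have km : (k < m)%N by apply: kmin; rewrite beta_total.
exists (Ordinal km) => /=; rewrite xk andbT leNgt.
by apply/negP => /kmin; rewrite ltnn.
Qed.

Lemma piece_unique lam x (i j : 'I_m) : Lambda lam ->
  beta lam i <= x < beta lam i.+1 -> beta lam j <= x < beta lam j.+1 -> i = j.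
Proof.
move=> lam_gt0 /andP[ix xi] /andP[jx xj]; apply/val_inj/eqP => /=.
rewrite eqn_leq; apply/andP; split; rewrite leqNgt; apply/negP.
  move=> /(beta_le lam_gt0) /(lt_le_trans xj) /lt_le_trans /(_ ix).
  by rewrite ltxx.
move=> /(beta_le lam_gt0) /(lt_le_trans xi) /lt_le_trans /(_ jx).
by rewrite ltxx.
Qed.

Lemma piece_sub lam x (j : 'I_m) : Lambda lam ->
  beta lam j <= x < beta lam j.+1 -> Ilam lam x.
Proof.
move=> lam_gt0 /andP[jx xj]; rewrite /Ilam/= in_itv/=.
by rewrite (le_trans (beta_ge0 j lam_gt0) jx) (lt_le_trans xj)// beta_le_total.
Qed.

Lemma lam_perm_Lambda lam p : Lambda lam -> Lambda (lam_perm lam p).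
Proof. by move=> lam_gt0 j; rewrite mxE. Qed.

Lemma lam_perm_total lam p : lam_total (lam_perm lam p) = lam_total lam.
Proof.
rewrite /lam_total (reindex_inj (@perm_inj _ p))/=.
by apply: eq_bigr => j _; rewrite mxE permK.
Qed.

Lemma Ilam_perm lam p : Ilam (lam_perm lam p) = Ilam lam.
Proof. by rewrite /Ilam lam_perm_total. Qed.

Lemma iet_on_piece lam p x (j : 'I_m) : Lambda lam ->
  beta lam j <= x < beta lam j.+1 ->
  iet lam p x = x - beta lam j + beta (lam_perm lam p) (p j).
Proof.
move=> lam_gt0 jx; rewrite /iet.
case: pickP => [i ix|/(_ j)]; last by rewrite jx.
by rewrite (piece_unique lam_gt0 ix jx).
Qed.

Lemma iet_image_piece lam p x (j : 'I_m) : Lambda lam ->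
  beta lam j <= x < beta lam j.+1 ->
  beta (lam_perm lam p) (p j) <= iet lam p x < beta (lam_perm lam p) (p j).+1.
Proof.
move=> lam_gt0 jx; rewrite (iet_on_piece p lam_gt0 jx) betaS mxE permK.
by move: jx; rewrite betaS => /andP[? ?]; apply/andP; split; lra.
Qed.

Lemma iet_bij lam p : Lambda lam -> set_bij (Ilam lam) (Ilam lam) (iet lam p).
Proof.
move=> lam_gt0; have lamp_gt0 := lam_perm_Lambda p lam_gt0; split.
- move=> x /piece_exists[j /(iet_image_piece p lam_gt0)] /(piece_sub lamp_gt0).
  by rewrite Ilam_perm.
- move=> x y /[!inE] /piece_exists[i ix] /piece_exists[j jy] Txy.
  have := iet_image_piece p lam_gt0 ix; rewrite Txy => /(piece_unique lamp_gt0).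
  move=> /(_ _ (iet_image_piece p lam_gt0 jy)) /perm_inj ij.
  move: Txy; rewrite (iet_on_piece p lam_gt0 ix) (iet_on_piece p lam_gt0 jy) ij.
  by move=> ?; lra.
- move=> y; rewrite -{1}(Ilam_perm lam p) => /piece_exists[k ky].
  pose j := (p^-1)%g k; have pj : p j = k by rewrite permKV.
  have jx : beta lam j <= y - beta (lam_perm lam p) k + beta lam j
            < beta lam j.+1.
    move: ky; rewrite !betaS mxE -/j => /andP[? ?].
    by apply/andP; split; lra.
  exists (y - beta (lam_perm lam p) k + beta lam j).
    exact: piece_sub jx.
  by rewrite (iet_on_piece p lam_gt0 jx) pj; lra.
Qed.

(** The pieces are closed on the left, so every point has points of its own
    piece on its right, including the left ends of the pieces. *)
Lemma iet_right_translation lam p x : Lambda lam -> Ilam lam x ->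
  exists2 d, 0 < d & forall y, x <= y < x + d ->
    iet lam p y - iet lam p x = y - x.
Proof.
move=> lam_gt0 /piece_exists[j jx]; exists (beta lam j.+1 - x).
  by case/andP: jx => _ ?; lra.
move=> y xy; have jy : beta lam j <= y < beta lam j.+1.
  by move: jx xy => /andP[? ?] /andP[? ?]; apply/andP; split; lra.
by rewrite (iet_on_piece p lam_gt0 jx) (iet_on_piece p lam_gt0 jy); lra.
Qed.

End Pieces.

(** * Repetitions in sequences *)

Section Repetitions.
Variable R : realType.

Lemma limn_esup_unbounded (u : nat -> \bar R) :
  (forall K n0 : nat, exists2 n, (n0 <= n)%N & (K%:R%:E <= u n)%E) ->
  limn_esup u = +oo%E.
Proof.
move=> u_big; apply/eqP; rewrite -leye_eq.
apply: le_ereal_inf_tmp => _ [V Voo <-].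
have [n0 _ n0V] := Voo; rewrite leye_eq; apply/eqP/eq_infty => r.
have [n n0n] := u_big (Num.trunc `|r|).+1 n0.
have rT : (r <= (Num.trunc `|r|).+1%:R)%R.
  by rewrite (le_trans (ler_norm r))// ltW// truncnS_gt.
rewrite -lee_fin in rT; move=> /(le_trans rT)/le_trans; apply.
by apply: ereal_sup_ubound; exists n => //; exact: n0V.
Qed.

Lemma normalized_nat_sup_ge (P : set nat) (n K : nat) : (0 < n)%N ->
  P (K * n)%N -> (K%:R%:E <= 1 + (n%:R^-1)%:E * nat_sup R P)%E.
Proof.
move=> n0 PKn; have sup_ge : ((K * n)%:R%:E <= nat_sup R P)%E.
  by rewrite /nat_sup le_max ereal_sup_ubound ?orbT//; exists (K * n)%N.
have nV0 : (0 <= (n%:R^-1 : R)%:E)%E by rewrite lee_fin invr_ge0.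
apply: le_trans (leeD2l 1%E (lee_wpmul2l nV0 sup_ge)).
rewrite -EFinM -EFinD lee_fin natrM mulrCA mulVf ?mulr1 ?lerDr//.
by rewrite pnatr_eq0 -lt0n.
Qed.

Variable A : Type.
Implicit Types w : int -> A.

Definition periodic_window w (L N : nat) : Prop :=
  forall k : int, `|k| <= (L * N)%:Z -> w (k + N%:Z) = w k.

Lemma periodic_window_mul w (L N j : nat) (k : int) :
  periodic_window w L N -> (j <= L)%N -> `|k| <= ((L - j) * N)%:Z ->
  w (k + (j * N)%:Z) = w k.
Proof.
move=> wper; elim: j k => [|j IH] k jL kL; first by rewrite mul0n addr0.
have -> : k + (j.+1 * N)%:Z = (k + (j * N)%:Z) + N%:Z by rewrite mulSn; lia.
rewrite wper; last by nia.
by apply: IH; [exact: ltnW|nia].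
Qed.

(** The period [N] may stay bounded as [L] grows. A window of
    [(K + 1) * (n + 1)] periods [N], read as a window of [K + 1] periods
    [(n + 1) * N], provides [K] repetitions of a period larger than [n]; the
    last period is lost to the shift. *)
Lemma pinned_window w (K n : nat) :
  (forall L, exists2 N, (0 < N)%N & periodic_window w L N) ->
  exists2 n', (n <= n')%N /\ (0 < n')%N & forall k : nat,
    (1 <= k <= K * n')%N ->
    w k%:Z = w (k%:Z + n'%:Z) /\ w (n'%:Z + 1 - k%:Z) = w (1 - k%:Z).
Proof.
move=> /(_ (K.+1 * n.+1)%N)[N N0 wper].
exists (n.+1 * N)%N; first by split; nia.
have step (k : int) : `|k| <= (K * (n.+1 * N))%:Z ->
    w (k + (n.+1 * N)%:Z) = w k.
  by move=> kK; apply: (periodic_window_mul wper) => //; nia.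
move=> k /andP[k1 kK]; split; first by rewrite step//; lia.
by rewrite -addrA addrC step//; lia.
Qed.

Lemma periodic_windows_pinned_rep w :
  (forall L, exists2 N, (0 < N)%N & periodic_window w L N) ->
  pinned_rep R w = +oo%E.
Proof.
move=> wper; apply: limn_esup_unbounded => K n0.
have [n [n0n n_gt0] wn] := pinned_window K.+1 n0 wper.
exists n => //; apply: (@le_trans _ _ K.+1%:R%:E).
  by rewrite lee_fin ler_nat.
by apply: normalized_nat_sup_ge => //; split; [rewrite muln_gt0|].
Qed.

Lemma periodic_windows_rep w :
  (forall L, exists2 N, (0 < N)%N & periodic_window w L N) ->
  rep R w = +oo%E.
Proof.
move=> wper; apply: limn_esup_unbounded => K n0.
have [n [n0n n_gt0] wn] := pinned_window K.+1 n0 wper.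
exists n => //; apply: (@le_trans _ _ K.+1%:R%:E).
  by rewrite lee_fin ler_nat.
apply: normalized_nat_sup_ge => //; split; [by rewrite muln_gt0|].
by move=> k /wn[].
Qed.

End Repetitions.

(** * Orbits and codings *)

Section Orbits.
Variables (R : realType) (m : nat) (lam : 'rV[R]_m) (p : 'S_m).
Hypothesis lam_gt0 : Lambda lam.
Let T := iet lam p.

Lemma iter_iet_Ilam n x : Ilam lam x -> Ilam lam (iter n T x).
Proof.
have [TI _ _] := iet_bij p lam_gt0.
by move=> Ix; elim: n => //= n /TI.
Qed.

Lemma iter_iet_inj n x y : Ilam lam x -> Ilam lam y ->
  iter n T x = iter n T y -> x = y.
Proof.
have [_ Tinj _] := iet_bij p lam_gt0.
move=> Ix Iy; elim: n => //= n IH /Tinj; rewrite !inE => /(_ _ _)/IH; apply.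
  exact: iter_iet_Ilam.
exact: iter_iet_Ilam.
Qed.

Lemma iet_pow_Ilam (n : int) x : Ilam lam x -> Ilam lam (iet_pow lam p n x).
Proof.
case: n => n Ix; first exact: iter_iet_Ilam.
have [_ _ Tsurj] := iet_bij p lam_gt0.
rewrite /iet_pow; elim: n.+1 => //= k Ik.
apply: (surjpinv_image_sub Tsurj).
by exists (iter k ('pinv_(fun=> 0) (Ilam lam) T) x).
Qed.

Lemma iet_pow_iter (n : int) (a b : nat) x : Ilam lam x -> a%:Z + n = b%:Z ->
  iet_pow lam p n (iter a T x) = iter b T x.
Proof.
have [_ Tinj _] := iet_bij p lam_gt0.
case: n => n Ix /=; first by move=> ab; rewrite -iterD addnC; congr iter; lia.
rewrite NegzE => ab; have {ab} -> : a = (n.+1 + b)%N by lia.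
rewrite -(iterS n); elim: n.+1 => // {}n IH.
rewrite iterSr addSn [iter _.+1 T x]iterS pinvKV//.
by rewrite inE; exact: iter_iet_Ilam.
Qed.

Lemma coding_exists M (J : 'I_M -> set R) x : interval_partition lam J ->
  Ilam lam x -> exists s, is_coding lam p J x s.
Proof.
move=> [[coverJ trivJ _] _] Ix.
have cell n : exists l, J l (iet_pow lam p n x).
  by have := iet_pow_Ilam n Ix; rewrite -coverJ => -[l _]; exists l.
have [s sJ] := choice cell; exists s => n l; split=> [<-//|Jl].
by apply: (trivJ _ _ I I); exists (iet_pow lam p n x).
Qed.

(** The counterpart of [periodic_window] for orbits. It mentions no coding
    sequence, so that its exceptional set is defined before codings are chosen. *)
Definition recurrent_orbit M (J : 'I_M -> set R) (L N : nat) x : Prop :=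
  forall k : int, `|k| <= (L * N)%:Z ->
  forall l, J l (iet_pow lam p k x) <-> J l (iet_pow lam p (k + N%:Z) x).

Lemma coding_periodic_window M (J : 'I_M -> set R) (L N : nat) x s :
  is_coding lam p J x s -> recurrent_orbit J L N x -> periodic_window s L N.
Proof.
move=> sJ xrec k kL; apply: (sJ _ _).2; apply: (xrec k kL _).1.
exact: (sJ _ _).1.
Qed.

End Orbits.

(** * Intervals and their end points *)

Section Intervals.
Variable R : realType.
Implicit Types (K : set R) (c r u v x z : R).

Lemma interval_within K : is_interval K -> forall x, inf K < x < sup K -> K x.
Proof.
move=> Kitv x /andP[ix xs]; have [K0|/nonemptyPn K0] := pselect (K !=set0).
  have [u Ku ux] := inf_lt K0 ix; have [v Kv xv] := sup_gt K0 xs.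
  by apply: (Kitv _ _ Ku Kv); rewrite !ltW.
by have := lt_trans ix xs; rewrite K0 inf0 sup0 ltxx.
Qed.

Lemma interval_exit K u v : is_interval K -> K u -> ~ K v ->
  u <= inf K <= v \/ v <= inf K <= u \/ u <= sup K <= v \/ v <= sup K <= u.
Proof.
move=> Kitv Ku Kv; have K0 : K !=set0 by exists u.
have [uv|vu] := leP u v.
  have Kubv : ubound K v.
    move=> z Kz; rewrite leNgt; apply/negP => vz; apply: Kv.
    by apply: (Kitv _ _ Ku Kz); rewrite uv ltW.
  right; right; left; rewrite ge_sup// andbT; apply: ub_le_sup => //.
  by exists v.
have Klbv : lbound K v.
  move=> z Kz; rewrite leNgt; apply/negP => vz; apply: Kv.
  by apply: (Kitv _ _ Kz Ku); rewrite !ltW.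
right; left; rewrite lb_le_inf//=; apply: ge_inf => //.
by exists v.
Qed.

Lemma interval_no_end K z r u v : is_interval K ->
  r < `|inf K - z| -> r < `|sup K - z| -> `|u - z| <= r -> `|v - z| <= r ->
  K u -> K v.
Proof.
move=> Kitv ri rs; rewrite !ler_distl => /andP[zu uz] /andP[zv vz] Ku.
apply: contrapT => /(interval_exit Kitv Ku).
have inball c : u <= c <= v \/ v <= c <= u -> `|c - z| <= r.
  by rewrite ler_distl => -[|] /andP[? ?]; apply/andP; split; lra.
move=> ends; suff [] : `|inf K - z| <= r \/ `|sup K - z| <= r.
- by rewrite leNgt ri.
- by rewrite leNgt rs.
- by case: ends => [h|[h|h]]; [left|left|right]; apply: inball; tauto.
Qed.

(** [D] lists the end points of the intervals that form the cells; a segment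
    that meets none of them cannot leave a cell. *)
Lemma partition_end_points M (J : 'I_M -> set R) :
  (forall l, finite_union_of_intervals (J l)) ->
  exists D : seq R, forall z r u v, (forall c, c \in D -> r < `|c - z|) ->
    `|u - z| <= r -> `|v - z| <= r -> forall l, J l u -> J l v.
Proof.
move=> Jitv; have cell_ends l : exists D : seq R, forall z r u v,
    (forall c, c \in D -> r < `|c - z|) ->
    `|u - z| <= r -> `|v - z| <= r -> J l u -> J l v.
  have [n [K [Kitv ->]]] := Jitv l.
  exists ([seq inf (K i) | i : 'I_n] ++ [seq sup (K i) | i : 'I_n]).
  move=> z r u v far uz vz [i _ Kiu]; exists i => //.
  apply: (interval_no_end (Kitv i) _ _ uz vz Kiu); apply: far;
    rewrite mem_cat; apply/orP; [left|right]; exact: map_f (mem_enum _ _).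
have [D HD] := choice cell_ends.
exists (flatten [seq D l | l : 'I_M]) => z r u v far uz vz l.
apply: (HD l z r) => // c cD; apply: far; apply/flatten_mapP.
by exists l => //; exact: mem_enum.
Qed.

End Intervals.

(** * Towers over an interval *)

Section Tower.
Variables (R : realType) (m : nat) (lam : 'rV[R]_m) (p : 'S_m).
Hypothesis lam_gt0 : Lambda lam.
Let T := iet lam p.
Variables (N : nat) (B : set R) (a b : R).
Hypotheses (ab : a < b) (oB : forall x : R, a < x < b -> B x)
  (Bc : forall x, B x -> a <= x <= b) (BI : B `<=` Ilam lam).
Hypothesis linT : forall l, (l < N)%N -> linear_on T (iter l T @` B).

(** An affine map that is a translation on the right of one point has slope
    1. *)
Lemma tower_translations : exists tau : nat -> R,
  forall l, (l <= N)%N -> forall x, B x -> iter l T x = x + tau l.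
Proof.
have ltab := ab; pose c := (a + b) / 2.
have Bmid : B c by apply: oB; rewrite /c; lra.
exists (fun l => iter l T c - c); elim=> [|l IH] lN x Bx /=.
  by rewrite subrr addr0.
have [u [v Tuv]] := linT lN.
have Tl z : B z -> T (iter l T z) = u * iter l T z + v.
  by move=> Bz; apply: Tuv; exists z.
have [d d0 Td] :=
  iet_right_translation p lam_gt0 (iter_iet_Ilam p lam_gt0 l (BI Bmid)).
pose h := Num.min (d / 2) ((b - a) / 4).
have h0 : 0 < h by rewrite lt_min; apply/andP; split; lra.
have hd : h <= d / 2 by rewrite ge_min lexx.
have hb : h <= (b - a) / 4 by rewrite ge_min lexx orbT.
have Bch : B (c + h) by apply: oB; rewrite /c; lra.
have u1 : u = 1.
  have := Td (iter l T (c + h)); rewrite -/T !Tl// (IH (ltnW lN) _ Bch).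
  move: (iter l T c) => w slope; apply: (mulIf (lt0r_neq0 h0)).
  transitivity (u * (c + h + (w - c)) + v - (u * w + v)); first by ring.
  by rewrite slope; [ring|lra].
by rewrite !Tl// (IH (ltnW lN) x Bx) u1; ring.
Qed.

Hypothesis disjT : forall l, (1 <= l < N)%N -> B `&` iter l T @` B = set0.

Lemma tower_disjoint l1 l2 x1 x2 : (l1 < N)%N -> (l2 < N)%N -> B x1 -> B x2 ->
  iter l1 T x1 = iter l2 T x2 -> l1 = l2.
Proof.
wlog l12 : l1 l2 x1 x2 / (l1 <= l2)%N.
  move=> wl l1N l2N Bx1 Bx2 eqT; have [|/ltnW] := leqP l1 l2.
    by move=> l12; exact: (wl l1 l2 x1 x2).
  by move=> l21; apply/esym; exact: (wl l2 l1 x2 x1).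
move=> l1N l2N Bx1 Bx2; rewrite -(subnKC l12) iterD.
move=> /(iter_iet_inj lam_gt0 (BI Bx1) (iter_iet_Ilam p lam_gt0 _ (BI Bx2))) eqx.
case: (posnP (l2 - l1)) => [->|l0]; first by rewrite addn0.
have : (B `&` iter (l2 - l1) T @` B) x1 by split => //; exists x2.
by rewrite disjT// l0 (leq_ltn_trans (leq_subr _ _)).
Qed.

Variable tau : nat -> R.
Hypothesis tauE :
  forall l, (l <= N)%N -> forall x, B x -> iter l T x = x + tau l.

Lemma tower_return (x : R) n r : (r <= N)%N ->
  (forall i, (i <= n)%N -> B (x + i%:R * tau N)) ->
  iter (n * N + r) T x = x + n%:R * tau N + tau r.
Proof.
move=> rN Bx; have ret i : (i <= n)%N -> iter (i * N) T x = x + i%:R * tau N.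
  elim: i => [|i IH] ilt; first by rewrite mul0r addr0.
  rewrite mulSn iterD IH 1?ltnW// tauE ?leqnn//; last exact/Bx/ltnW.
  by rewrite -[in RHS](@natr1 R); ring.
by rewrite addnC iterD ret// tauE//; exact: Bx.
Qed.

(** Each passage through the tower displaces the orbit by [tau N], so that during
    [L + 1] passages before and after time 0 its points on level [k] stay within
    [r] of [x + tau k], where no [c] in [D] separates them. *)
Lemma tower_recurrent M (J : 'I_M -> set R) (D : seq R) L l (x : R)
    (r := L.+1%:R * `|tau N|) :
  (forall z s u v : R, (forall c, c \in D -> s < `|c - z|) ->
    `|u - z| <= s -> `|v - z| <= s -> forall q, J q u -> J q v) ->
  (l < N)%N -> a + r < x < b - r ->
  (forall k c, (k < N)%N -> c \in D -> r < `|c - (x + tau k)|) ->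
  recurrent_orbit lam p J L N (x + tau l).
Proof.
move=> JD lN /andP[ax xb] far k kL q.
(* The orbit is followed forward from [x0], which returns to [x] after [L + 1]
   passages: no negative power is left to compute. *)
set t := tau N in r ax xb far *; pose Q := L.+1; pose x0 := x - Q%:R * t.
have drift (i : nat) : (i <= Q + Q)%N -> `|x0 + i%:R * t - x| <= r.
  move=> iQ; have -> : x0 + i%:R * t - x = (i%:R - Q%:R) * t by rewrite /x0; ring.
  rewrite normrM ler_wpM2r// ler_norml; apply/andP; split.
    by rewrite lerBrDr addrC subrr ler0n.
  by rewrite lerBlDr -natrD ler_nat.
have Bdrift i : (i <= Q + Q)%N -> B (x0 + i%:R * t).
  move=> /drift; rewrite ler_distl => /andP[? ?].
  by apply: oB; apply/andP; split; lra.
have ret n s : (n <= Q + Q)%N -> (s < N)%N ->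
    iter (n * N + s) T x0 = x0 + n%:R * t + tau s.
  move=> nQ sN; apply: tower_return; first exact: ltnW.
  by move=> i iln; apply/Bdrift/(leq_trans iln).
have <- : iter (Q * N + l) T x0 = x + tau l.
  by rewrite ret ?leq_addr// /x0; ring.
have Ix0 : Ilam lam x0.
  by apply: BI; have := Bdrift 0%N isT; rewrite mul0r addr0.
have N0 : (0 < N)%N by exact: leq_ltn_trans lN.
pose w := absz ((Q * N + l)%:Z + k); have wE : (Q * N + l)%:Z + k = w%:Z.
  by rewrite /w /Q mulSn; lia.
rewrite (iet_pow_iter p lam_gt0 Ix0 wE).
have wNE : (Q * N + l)%:Z + (k + N%:Z) = (w + N)%:Z by rewrite addrA wE; lia.
rewrite (iet_pow_iter p lam_gt0 Ix0 wNE) (divn_eq w N).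
set n := (w %/ N)%N; set s := (w %% N)%N; have sN : (s < N)%N by rewrite ltn_mod.
have nQ : (n < Q + Q)%N.
  by rewrite /n ltn_divLR// mulnDl /Q mulSn; rewrite /Q mulSn in wE; lia.
have -> : (n * N + s + N = n.+1 * N + s)%N by rewrite mulSn; lia.
rewrite (ret n s (ltnW nQ) sN) (ret n.+1 s nQ sN).
have near (i : nat) : (i <= Q + Q)%N ->
    `|x0 + i%:R * t + tau s - (x + tau s)| <= r.
  by move=> /drift; congr (`|_| <= _); ring.
by split; apply: (JD (x + tau s) r) => //; try (exact: near); try exact/near/ltnW;
  move=> c cD; exact: far.
Qed.

(** The levels are disjoint, so an end point of a cell lies in at most one of
    them: the number of short intervals to be removed from the base is bounded
    independently of the height [N]. *)
Lemma tower_bad_centers (D : seq R) (r : R) :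
  exists E : seq R, size E = (size D).+2 /\
  forall x, B x -> (forall e, e \in E -> r < `|x - e|) ->
    a + r < x < b - r /\
    (forall k c, (k < N)%N -> c \in D -> r < `|c - (x + tau k)|).
Proof.
have center c : exists e, forall k x, (k < N)%N -> a + r < x < b - r ->
    `|c - (x + tau k)| <= r -> `|x - e| <= r.
  have [[k0 [k0N Bk0]]|none] := pselect (exists k, (k < N)%N /\ B (c - tau k)).
    exists (c - tau k0) => k x kN /andP[ax xb]; rewrite ler_distl => /andP[cl cr].
    have Bk : B (c - tau k) by apply: oB; apply/andP; split; lra.
    have <- : k = k0.
      apply: (tower_disjoint kN k0N Bk Bk0).
      by rewrite (tauE (ltnW kN) Bk) (tauE (ltnW k0N) Bk0) !subrK.
    by rewrite ler_distl; apply/andP; split; lra.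
  (* An end point outside the tower is not close to the middle part of any
     level: any value will do. *)
  exists 0 => k x kN /andP[ax xb]; rewrite ler_distl => /andP[cl cr].
  by case: none; exists k; split=> //; apply: oB; apply/andP; split; lra.
have [e eP] := choice center.
exists [:: a, b & map e D]; rewrite /= size_map; split=> // x Bx far.
have /andP[ax xb] := Bc Bx.
have axr : a + r < x < b - r.
  have := far a; rewrite inE eqxx => /(_ isT).
  have := far b; rewrite !inE eqxx orbT => /(_ isT).
  rewrite ler0_norm ?subr_le0// ger0_norm ?subr_ge0// => ? ?.
  by apply/andP; split; lra.
split=> // k c kN cD; rewrite ltNge; apply/negP => /(eP _ _ _ kN axr).
by rewrite leNgt far// !inE map_f ?orbT.
Qed.

End Tower.

(** * Measure estimates *)

Section Measure.
Variable R : realType.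
Local Notation mu := (@lebesgue_measure R).

Lemma small_covers_negligible (A : set R) :
  (forall d : R, 0 < d -> exists C : set R,
    [/\ measurable C, A `<=` C & (mu C <= d%:E)%E]) -> mu.-negligible A.
Proof.
move=> cov; have small n : exists C : set R,
    [/\ measurable C, A `<=` C & (mu C <= (n.+1%:R^-1)%:E)%E].
  by apply: cov; rewrite invr_gt0.
have [C CP] := choice small.
have mC : measurable (\bigcap_n C n).
  by apply: bigcapT_measurable => n; case: (CP n).
exists (\bigcap_n C n); split=> //; last first.
  by move=> x Ax n _; case: (CP n) => _ /(_ x Ax).
apply/eqP; rewrite eq_le measure_ge0 andbT; apply/lee_addgt0Pr => e e0.
rewrite add0e; have [n ne] : exists n : nat, (n.+1%:R^-1 <= e).
  exists (Num.trunc e^-1); rewrite invf_ple ?posrE//.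
  by rewrite ltW// truncnS_gt.
have [mCn _ Cn] := CP n; apply: (@le_trans _ _ (mu (C n))).
  by apply: le_measure; rewrite ?inE//; exact: bigcap_inf.
by rewrite (le_trans Cn)// lee_fin.
Qed.

Lemma measure_itv (s1 s2 : bool) (u v : R) : u <= v ->
  mu [set` Interval (BSide s1 u) (BSide s2 v)] = (v - u)%:E.
Proof.
move=> uv; rewrite lebesgue_measure_itv/= lte_fin.
by case: ltgtP uv => // -> _; rewrite subrr.
Qed.

Definition neighbourhood (E : seq R) (r : R) : set R :=
  \bigcup_(z in [set` E]) `[z - r, z + r]%classic.

Lemma neighbourhood_measure (E : seq R) (r : R) : 0 <= r ->
  measurable (neighbourhood E r) /\
  (mu (neighbourhood E r) <= ((size E)%:R * (r *+ 2))%:E)%E.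
Proof.
move=> r0; rewrite /neighbourhood bigcup_seq; elim: E => [|z E [mE IH]].
  by rewrite big_nil; split => //; rewrite measure0 mul0r.
rewrite big_cons; split; first exact: measurableU.
apply: (le_trans (measureU2 mu _ mE)); first exact: measurable_itv.
have -> : (size (z :: E))%:R * (r *+ 2) = r *+ 2 + (size E)%:R * (r *+ 2).
  by rewrite /= -natr1; ring.
rewrite EFinD; apply: leeD IH.
apply: (@le_trans _ _ (mu `[z - r, z + r]%classic)) => //.
by rewrite measure_itv ?lee_fin; lra.
Qed.

Lemma translated_interval (B : set R) (f : R -> R) (t : R) : is_interval B ->
  (forall x, B x -> f x = x + t) -> is_interval (f @` B).
Proof.
move=> Bitv ft _ _ [x Bx <-] [y By <-] z; rewrite !ft// => /andP[xz zy].
have Bz : B (z - t) by apply: (Bitv _ _ Bx By); lra.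
by exists (z - t) => //; rewrite ft// subrK.
Qed.

(** Positivity is asked of a subset [A], which is arbitrary: it serves for the
    overlap of an interval with its return, at a stage where the return is not
    yet known to be measurable. *)
Lemma interval_measure_pos (A B : set R) (u v : R) : is_interval B ->
  B `<=` `[u, v]%classic -> A `<=` B -> (0 < mu A)%E ->
  [/\ inf B < sup B, (forall x : R, inf B < x < sup B -> B x) &
      forall x, B x -> inf B <= x <= sup B].
Proof.
move=> Bitv Buv AB A0; have Bb x : B x -> inf B <= x <= sup B.
  move=> Bx; rewrite ge_inf ?ub_le_sup//.
    by exists v => y /Buv; rewrite /= in_itv/= => /andP[].
  by exists u => y /Buv; rewrite /= in_itv/= => /andP[].
split=> //; last exact: interval_within.
rewrite ltNge; apply/negP => ba; have : A `<=` [set inf B].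
  move=> x /AB/Bb/andP[ix xs]; apply/eqP.
  by rewrite eq_le ix (le_trans xs ba).
case/subset_set1 => AE; move: A0.
  by rewrite AE measure0 ltxx.
by rewrite AE lebesgue_measure_set1 ltxx.
Qed.

(** An interval and its translate by [t] overlap on a set of measure at most
    the positive part of its length minus [|t|]. *)
Lemma return_drift (B : set R) (f : R -> R) (a b t e : R) :
  a < b -> is_interval B ->
  (forall x, a < x < b -> B x) -> (forall x, B x -> a <= x <= b) ->
  (forall x, B x -> f x = x + t) -> 0 < e <= 1 ->
  ((1 - e)%:E * mu B < mu (B `&` f @` B))%E -> `|t| < e * (b - a).
Proof.
move=> ab Bitv oB Bc ft /andP[e0 e1] overlap.
have mB : measurable B by exact: measurable_realfun.is_interval_measurable.
have mfB : measurable (f @` B).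
  apply: measurable_realfun.is_interval_measurable.
  exact: translated_interval ft.
have muB : ((b - a)%:E <= mu B)%E.
  rewrite -(measure_itv false true (ltW ab)); apply: le_measure; rewrite ?inE//.
have e1E : (0 <= (1 - e)%:E)%E by rewrite lee_fin subr_ge0.
have {}overlap := le_lt_trans (lee_wpmul2l e1E muB) overlap.
pose u := Num.max a (a + t); pose v := Num.min b (b + t).
have sub : B `&` f @` B `<=` `[u, v]%classic.
  move=> x [/Bc/andP[ax xb] [y By fy]]; rewrite /= in_itv/= ge_max le_min ax xb/=.
  by move: (Bc _ By) fy; rewrite ft//; lra.
have {}overlap : ((1 - e)%:E * (b - a)%:E < mu `[u, v]%classic)%E.
  apply: (lt_le_trans overlap); apply: le_measure; rewrite ?inE//.
  exact: measurableI.
have [uv|vu] := leP u v; last first.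
  move: overlap; rewrite set_itv_ge ?bnd_simp -?ltNge// measure0 -EFinM lte_fin.
  by rewrite ltNge mulr_ge0//; lra.
move: overlap; rewrite measure_itv// -EFinM lte_fin /u /v.
by case: (leP a (a + t)); case: (leP b (b + t)); rewrite ?maxEle ?minEle;
  case: ger0P; nra.
Qed.

End Measure.

Section TowerMeasure.
Variables (R : realType) (m : nat) (lam : 'rV[R]_m) (p : 'S_m).
Hypothesis lam_gt0 : Lambda lam.
Local Notation mu := (@lebesgue_measure R).
Let T := iet lam p.
Variables (N : nat) (B : set R) (a b : R) (tau : nat -> R).
Hypotheses (ab : a < b) (oB : forall x : R, a < x < b -> B x)
  (BI : B `<=` Ilam lam) (Bitv : is_interval B).
Hypothesis disjT : forall l, (1 <= l < N)%N -> B `&` iter l T @` B = set0.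
Hypothesis tauE :
  forall l, (l <= N)%N -> forall x, B x -> iter l T x = x + tau l.

Lemma level_measurable l : (l <= N)%N -> measurable (iter l T @` B).
Proof.
move=> lN; apply: measurable_realfun.is_interval_measurable.
exact: translated_interval (tauE lN).
Qed.

Lemma tower_measurable : measurable (\bigcup_(l < N) iter l T @` B).
Proof.
by apply: bigcup_measurable => l /= lN; apply: level_measurable; exact: ltnW.
Qed.

Lemma tower_sub : \bigcup_(l < N) iter l T @` B `<=` Ilam lam.
Proof. by move=> _ [l _ [x Bx <-]]; exact/(iter_iet_Ilam p lam_gt0)/BI. Qed.

Lemma Ilam_measure : mu (Ilam lam) = (lam_total lam)%:E.
Proof. by rewrite /Ilam measure_itv ?subr0//; exact: lam_total_ge0. Qed.

(** The levels are disjoint and each has the length of the base. *)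
Lemma tower_height : N%:R * (b - a) <= lam_total lam.
Proof.
rewrite -lee_fin -Ilam_measure.
apply: (@le_trans _ _ (mu (\bigcup_(l < N) iter l T @` B))); last first.
  apply: le_measure; rewrite ?inE; [exact: tower_measurable|exact: measurable_itv|].
  exact: tower_sub.
rewrite bigcup_mkord (measure_bigsetU_ord _ xpredT); first last.
- move=> i j _ _ [_ [[x Bx <-] [y By yx]]]; apply/val_inj.
  by apply: (tower_disjoint lam_gt0 BI disjT (ltn_ord i) (ltn_ord j) Bx By).
- by move=> i; apply: level_measurable; exact: ltnW.
have -> : ((N%:R * (b - a))%:E = \sum_(i < N) (b - a)%:E)%E.
  by rewrite sumEFin sumr_const card_ord mulr_natl.
apply: lee_sum => i _; have iN := ltnW (ltn_ord i).
have -> : b - a = (b + tau i) - (a + tau i) by ring.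
have h := ab; rewrite -(measure_itv false true); last by lra.
apply: le_measure; rewrite ?inE; [exact: measurable_itv|exact: level_measurable|].
move=> x; rewrite /= in_itv/= => xab; have Bx : B (x - tau i) by apply: oB; lra.
by exists (x - tau i) => //; rewrite tauE// subrK.
Qed.

Lemma tower_complement e :
  (((1 - e) * lam_total lam)%:E < mu (\bigcup_(l < N) iter l T @` B))%E ->
  (mu (Ilam lam `\` \bigcup_(l < N) iter l T @` B) <= (e * lam_total lam)%:E)%E.
Proof.
move=> big; have mI : measurable (Ilam lam) by exact: measurable_itv.
have Ifin : (mu (Ilam lam) < +oo)%E by rewrite Ilam_measure ltry.
have := measureD (mu := mu) mI tower_measurable Ifin.
rewrite (setIidr tower_sub) => ->.
rewrite [X in (X - _)%E]Ilam_measure leeBlDr.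
  apply: (le_trans _ (leeD2l _ (ltW big))); rewrite -EFinD lee_fin.
  by rewrite -mulrDl addrC subrK mul1r.
rewrite ge0_fin_numE ?measure_ge0//; apply: le_lt_trans Ifin.
apply: le_measure; rewrite ?inE//; first exact: tower_measurable.
exact: tower_sub.
Qed.

End TowerMeasure.

(** * Recurrence of almost every orbit *)

(** The exceptional set is covered by the complement of a tower together with
    the translates, to all levels, of the short intervals about the bad centers
    of its base. As [e] tends to 0 the measure of this cover does too. *)
Lemma recurrent_orbit_ae (R : realType) (m : nat) (lam : 'rV[R]_m)
    (lam_gt0 : Lambda lam) (p : 'S_m) (M : nat) (J : 'I_M -> set R) (L : nat) :
  propertyV lam p -> (forall l, finite_union_of_intervals (J l)) ->
  {ae (@lebesgue_measure R), forall x, Ilam lam x ->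
     exists2 N, (0 < N)%N & recurrent_orbit lam p J L N x}.
Proof.
move=> hV /partition_end_points[D JD]; apply: small_covers_negligible => d d0.
set W := lam_total lam; have W0 : 0 <= W by exact: lam_total_ge0.
pose S : R := (size D).+2%:R; pose Q : R := L.+1%:R; pose G := 1 + S * Q *+ 2.
have S0 : 0 < S by rewrite ltr0n.
have Q0 : 0 < Q by rewrite ltr0n.
have G0 : 0 < G by rewrite addr_gt0// mulrn_wgt0// mulr_gt0.
(* The cover found below has measure at most [e * (G * W)]. *)
pose e := Num.min 1 (d / (G * (W + 1))).
have GW0 : 0 < G * (W + 1) by rewrite mulr_gt0// ltr_wpDl.
have e01 : 0 < e <= 1 by rewrite lt_min ltr01 divr_gt0//= ge_min lexx.
have eGW : e * (G * W) <= d.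
  apply: (@le_trans _ _ (e * (G * (W + 1)))); last first.
    by rewrite -ler_pdivlMr// ge_min lexx orbT.
  by case/andP: e01 => e0 _; rewrite !ler_pM2l// lerDl ler01.
have [e0 e1] := andP e01.
have [N [B [[N0 Bitv BI] [disjT linT big overlap]]]] := hV e e0.
have overlap0 := le_lt_trans _ overlap.
have {}overlap0 : (0 < lebesgue_measure (B `&` iter N (iet lam p) @` B))%E.
  by apply: overlap0; rewrite mule_ge0 ?measure_ge0// lee_fin subr_ge0.
have BW : B `<=` `[0, W]%classic.
  by move=> x /BI; rewrite /Ilam/= !in_itv/= => /andP[-> /ltW].
have [] := interval_measure_pos Bitv BW (@subIsetl _ _ _) overlap0.
set a := inf B; set b := sup B => ab oB Bc.
have [tau tauE] := tower_translations lam_gt0 ab oB BI linT.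
have drift := return_drift ab Bitv oB Bc (tauE N (leqnn N)) e01 overlap.
pose r := Q * `|tau N|; have r0 : 0 <= r by rewrite mulr_ge0// ltW.
have [E [sizeE EP]] := tower_bad_centers lam_gt0 oB Bc BI disjT tauE D r.
pose F := [seq z + tau l | l <- iota 0 N, z <- E].
have sizeF : size F = (N * (size D).+2)%N.
  by rewrite size_allpairs size_iota sizeE.
pose U := \bigcup_(l < N) iter l (iet lam p) @` B.
exists ((Ilam lam `\` U) `|` neighbourhood F r).
have [mF muF] := neighbourhood_measure F r0.
have mIU : measurable (Ilam lam `\` U).
  apply: measurableD; first exact: measurable_itv.
  exact: tower_measurable Bitv tauE.
split; first exact: measurableU.
  move=> x /not_implyP[Ix norec]; have [|xU] := pselect (U x); last by left.
  move=> [l lN [y By yx]]; right; apply: contrapT => xF; apply: norec.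
  exists N => //; rewrite -yx (tauE l (ltnW lN) y By).
  have [] := EP y By; last first.
    by move=> ? ?; exact: (tower_recurrent lam_gt0 ab oB BI tauE JD lN).
  move=> z zE; rewrite ltNge; apply/negP; rewrite ler_distl => yz; apply: xF.
  exists (z + tau l).
    by apply/allpairsP; exists (l, z); split=> //; rewrite mem_iota.
  by rewrite -yx (tauE l (ltnW lN) y By) /= in_itv/=; lra.
apply: (le_trans (measureU2 lebesgue_measure mIU mF)).
apply: (le_trans (leeD (tower_complement lam_gt0 BI Bitv tauE big) muF)).
rewrite -EFinD lee_fin; apply: le_trans eGW; rewrite sizeF.
have height := tower_height lam_gt0 ab oB BI Bitv disjT tauE.
have NrQ : N%:R * r <= Q * (e * W).
  rewrite /r mulrCA ler_pM2l//; apply: (@le_trans _ _ (N%:R * (e * (b - a)))).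
    by rewrite ler_wpM2l// ltW.
  by rewrite mulrCA ler_pM2l.
rewrite natrM -/S -/W.
have -> : N%:R * S * (r *+ 2) = S * (N%:R * r) *+ 2 by ring.
have -> : e * (G * W) = e * W + S * (Q * (e * W)) *+ 2 by rewrite /G; ring.
by rewrite lerD2l ler_pMn2r// ler_pM2l.
Qed.

Theorem theorem5 (R : realType) (m : nat) (hm : (1 < m)%N)
    (lam : 'rV[R]_m) (hlam : Lambda lam) (p : 'S_m)
    (hV : propertyV lam p)
    (M : nat) (J : 'I_M -> set R) (hJ : interval_partition lam J) :
  {ae (@lebesgue_measure R), forall x : R, Ilam lam x ->
     exists s : int -> 'I_M,
       [/\ is_coding lam p J x s, rep R s = +oo%E & pinned_rep R s = +oo%E]}.
Proof.
have [_ Jitv] := hJ.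
have := ae_foralln (fun L => recurrent_orbit_ae hlam L hV Jitv).
apply: filterS => x xrec Ix; have [s sJ] := coding_exists p hlam hJ Ix.
have sper L : exists2 N, (0 < N)%N & periodic_window s L N.
  have [N N0 xN] := xrec L Ix; exists N => //.
  exact: coding_periodic_window sJ xN.
exists s; split => //; first exact: periodic_windows_rep.
exact: periodic_windows_pinned_rep.
Qed.
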